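(* Let $K$ be an algebraically closed field of characteristic different from $2$, let $(W,S)$ be a right-angled Coxeter system, and let $\mathcal{H}$ be the generic Hecke algebra of type $(W,S)$ over $K$ with deformation parameters $(a_s)_{s\in S}$, $(b_s)_{s\in S}$ in $K$. Assume that $b_s\neq-\frac{a_s^2}{4}$ for each $s\in S$. Then $(T_{\mathcal{O}})_{\mathcal{O}}$, where $\mathcal{O}$ runs through the conjugacy classes of $W$, is a basis of the cocentre $\mathcal{H}/[\mathcal{H},\mathcal{H}]$ of $\mathcal{H}$.
   Context: A Coxeter system $(W,S)$ ($S$ finite) is right-angled if $\mathrm{ord}(st)\in\{1,2,\infty\}$ for all $s,t\in S$; $|w|$ is word length with respect to $S$. The generic Hecke algebra of type $(W,S)$ over $K$ with parameters $(a_s)$, $(b_s)$ is the unital $K$-algebra with basis $(T_w)_{w\in W}$ and multiplication determined by, for $s\in S$, $w\in W$: $T_sT_w=T_{sw}$ if $|sw|>|w|$ and $T_sT_w=a_sT_w+b_sT_{sw}$ if $|sw|<|w|$. $[\mathcal{H},\mathcal{H}]$ is the linear subspace spanned by all $ab-ba$, $a,b\in\mathcal{H}$. For a conjugacy class $\mathcal{O}\subseteq W$, $T_{\mathcal{O}}\in\mathcal{H}/[\mathcal{H},\mathcal{H}]$ denotes the image $T_w+[\mathcal{H},\mathcal{H}]$ of $T_w$ for an element $w$ of minimal length in $\mathcal{O}$ (this does not depend on the choice of $w$). *)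

(* Defs.v *)
From HB Require Import structures.
From mathcomp Require Import all_boot all_order all_algebra finmap.
From mathcomp Require Import boolp classical_sets.
From mathcomp Require Import generic_quotient ring_quotient.

Set Implicit Arguments.
Unset Strict Implicit.
Unset Printing Implicit Defensive.

Import GRing.Theory.

Local Open Scope classical_set_scope.
Local Open Scope ring_scope.

Section LinearAlgebra.
Variables (K : fieldType) (V : lmodType K).

Definition linear_span (A : set V) : set V :=
  [set v | exists s : seq (K * V),
     (forall x, x \in s -> A x.2) /\ v = \sum_(x <- s) x.1 *: x.2].

Definition linearly_independent (I : eqType) (e : I -> V) : Prop :=
  forall (s : seq I) (c : I -> K), uniq s ->
    \sum_(i <- s) c i *: e i = 0 -> forall i, i \in s -> c i = 0.

Definition is_basis (I : eqType) (e : I -> V) : Prop :=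
  linearly_independent e /\ linear_span (range e) = setT.

Definition in_span (A : set V) : {pred V} := fun v => `[< linear_span A v >].

Lemma in_span_submod_closed (A : set V) : submod_closed (in_span A).
Proof.
split; first by apply/asboolP; exists [::]; rewrite big_nil.
move=> k u v /asboolP[s [sA ->]] /asboolP[t [tA ->]]; apply/asboolP.
exists ([seq (k * x.1, x.2) | x <- s] ++ t); split.
  by move=> x; rewrite mem_cat => /orP[/mapP[y ys ->]|/tA//]; exact: (sA y).
rewrite big_cat big_map /= scaler_sumr; congr (_ + _).
by apply: eq_bigr => x _; rewrite scalerA.
Qed.

HB.instance Definition _ (A : set V) :=
  GRing.isSubmodClosed.Build K V (in_span A) (in_span_submod_closed A).

End LinearAlgebra.

(* MathComp only equips the quotient by a subgroup with a Z-module structure;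
   for a linear subspace the scalar multiplication descends as well. *)
Section QuotientSpace.
Variables (K : fieldType) (V : lmodType K) (A : set V).

Definition span_quot := Quotient.quot (in_span A).

HB.instance Definition _ := GRing.Zmodule.on span_quot.
HB.instance Definition _ : EqQuotient V (Quotient.equiv (in_span A)) span_quot :=
  EqQuotient.on span_quot.
HB.instance Definition _ : isZmodQuotient V (Quotient.equiv (in_span A))
  0 -%R +%R span_quot := ZmodQuotient.on span_quot.

Definition quot_scale (k : K) : span_quot -> span_quot :=
  lift_op1 span_quot ( *:%R k).

Lemma pi_scale (k : K) :
  {morph (\pi_span_quot : V -> span_quot) : x / k *: x >-> quot_scale k x}%qT.
Proof.
move=> x; unlock quot_scale; apply/eqP.
by rewrite -Quotient.idealrBE -scalerBr rpredZ // Quotient.idealrBE reprK.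
Qed.

Lemma quot_scalerA a b (v : span_quot) :
  quot_scale a (quot_scale b v) = quot_scale (a * b) v.
Proof. by rewrite -[v]reprK -!pi_scale scalerA. Qed.

Lemma quot_scale1r : left_id 1 quot_scale.
Proof. by move=> v; rewrite -[v]reprK -pi_scale scale1r. Qed.

Lemma quot_scalerDr : right_distributive quot_scale +%R.
Proof.
move=> a u v; rewrite -[u]reprK -[v]reprK -!(pi_scale, pi_addr).
by rewrite -scalerDr.
Qed.

Lemma quot_scalerDl v : {morph quot_scale^~ v : a b / a + b}.
Proof. by move=> a b; rewrite -[v]reprK -!pi_scale scalerDl pi_addr. Qed.

HB.instance Definition _ := GRing.Zmodule_isLmodule.Build K span_quot
  quot_scalerA quot_scale1r quot_scalerDr quot_scalerDl.

End QuotientSpace.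

Section Cocentre.
Variables (K : fieldType) (H : algType K).

Definition commutators : set H := [set z : H | exists x y : H, z = x * y - y * x].

Definition cocentre : lmodType K := span_quot commutators.

Definition to_cocentre (h : H) : cocentre := (\pi_(span_quot commutators) h)%qT.

End Cocentre.

Section CoxeterSystems.
Variables (W : groupType) (S : {fset W}).

Definition order_is (x : W) (n : nat) : Prop :=
  [/\ (0 < n)%N, (x ^+ n)%g = 1%g &
      forall m, (0 < m < n)%N -> (x ^+ m)%g <> 1%g].

Definition infinite_order (x : W) : Prop :=
  forall n, (0 < n)%N -> (x ^+ n)%g <> 1%g.

Definition word_prod (u : seq S) : W := (\prod_(s <- u) val s)%g.

(* The congruence on words presenting the group with generators S and relations
   (st)^m = 1, m = ord(st) finite; the case s = t makes every generator its own
   inverse, so words without formal inverses suffice. *)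
Inductive coxeter_equiv : seq S -> seq S -> Prop :=
| CoxRelator (s t : S) (m : nat) of order_is (val s * val t)%g m :
    coxeter_equiv (flatten (nseq m [:: s; t])) [::]
| CoxRefl u : coxeter_equiv u u
| CoxSym u v of coxeter_equiv u v : coxeter_equiv v u
| CoxTrans u v w of coxeter_equiv u v & coxeter_equiv v w : coxeter_equiv u w
| CoxCat u u' v v' of coxeter_equiv u u' & coxeter_equiv v v' :
    coxeter_equiv (u ++ v) (u' ++ v').

Definition coxeter_system : Prop :=
  [/\ forall s : S, order_is (val s) 2,
      forall w : W, exists u : seq S, w = word_prod u &
      forall u v : seq S, word_prod u = word_prod v -> coxeter_equiv u v].

Definition right_angled : Prop :=
  forall s t : S, [\/ order_is (val s * val t)%g 1,
                      order_is (val s * val t)%g 2 |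
                      infinite_order (val s * val t)%g].

Definition word_length (w : W) : nat :=
  xget 0%N [set n | (exists2 u : seq S, size u = n & w = word_prod u) /\
                    forall u : seq S, w = word_prod u -> (n <= size u)%N].

Definition conj_classes : set (set W) :=
  [set O | exists w : W, O = [set (w ^ x)%g | x in [set: W]]].

Definition min_length_rep (O : set W) : W :=
  xget 1%g [set w | O w /\ forall v, O v -> (word_length w <= word_length v)%N].

Section Hecke.
Variables (K : fieldType) (a b : S -> K) (H : algType K) (T : W -> H).

(* The rules for T_s T_w alone do not determine products T_1 T_w, so the usual
   convention that T_1 is the unit has to be spelled out. *)
Definition generic_hecke_algebra : Prop :=
  [/\ is_basis T,
      T 1%g = 1,
      forall (s : S) (w : W),
        (word_length w < word_length (val s * w)%g)%N ->
        T (val s) * T w = T (val s * w)%g &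
      forall (s : S) (w : W),
        (word_length (val s * w)%g < word_length w)%N ->
        T (val s) * T w = a s *: T w + b s *: T (val s * w)%g].

Definition T_class (O : set W) : cocentre H := to_cocentre (T (min_length_rep O)).

End Hecke.
End CoxeterSystems.

Arguments conj_classes W : clear implicits.

(* Main.v *)
Require Import Defs.
From HB Require Import structures.
From mathcomp Require Import all_boot all_order all_algebra finmap.
From mathcomp Require Import boolp classical_sets.
From mathcomp Require Import generic_quotient ring_quotient ring.

Import GRing.Theory.

Local Open Scope classical_set_scope.
Local Open Scope ring_scope.

Set Implicit Arguments.
Unset Strict Implicit.
Unset Printing Implicit Defensive.

(** The discriminant a_s^2 + 4 b_s of the quadratic relation
    T_s^2 = a_s T_s + b_s is nonzero, so over an algebraically closed field of
    characteristic not 2 it has a square root d_s <> 0, and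
    g_s = (2 T_s - a_s) / d_s satisfies g_s^2 = 1 ([involutive_generator_sq]).
    In the right-angled case the only other relations of W say that certain
    generators commute, and the g_s inherit these from the T_s.  Hence s |-> g_s
    extends to a multiplicative map U from W to the algebra ([coxeter_lift]).

    Writing T_w as the product of the T_s = a_s/2 + (d_s/2) g_s along a reduced
    word and expanding gives T_w = c_w U_w + (a combination of U_v with v shorter
    than w), where c_w <> 0 ([hecke_triangular]).  This triangularity is used
    twice, through [triangular_basis].  In the algebra it shows that (U_w) is a
    basis, so that the Hecke algebra is the group algebra of W.  The cocentre of
    a group algebra has a basis indexed by the conjugacy classes
    ([group_algebra_cocentre_basis]).  In the cocentre, order the classes by their
    minimal length: for w of minimal length in its class, the elements v in the
    expansion of T_w are shorter than w, so they lie in classes of strictly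
    smaller minimal length.  The images of the T_w are therefore triangular over
    the images of the U_w, and form a basis too. *)

(** * Spans and bases *)

Section LinearAlgebra.
Variables (K : fieldType) (V : lmodType K).
Implicit Types (A B : set V) (u v : V).

Lemma mem_in_span A v : A v -> v \in in_span A.
Proof.
move=> Av; apply/asboolP; exists [:: (1, v)]; rewrite big_seq1 scale1r.
by split=> // x; rewrite inE => /eqP->.
Qed.

Lemma in_span_ind A (P : V -> Prop) :
    P 0 -> (forall k u v, P u -> P v -> P (k *: u + v)) ->
    (forall v, A v -> P v) ->
  forall v, v \in in_span A -> P v.
Proof.
move=> P0 Plin PA _ /asboolP[s [sA ->]].
elim: s sA => [|x s IHs] sA; first by rewrite big_nil.
rewrite big_cons; apply: Plin; first by apply/PA/sA; rewrite mem_head.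
by apply: IHs => y ys; apply: sA; rewrite inE ys orbT.
Qed.

Lemma in_span_min A B v :
  (forall x, A x -> x \in in_span B) -> v \in in_span A -> v \in in_span B.
Proof.
move=> AB; elim/in_span_ind: v / => // [|k u v Bu Bv]; first exact: rpred0.
by rewrite rpredD ?rpredZ.
Qed.

Lemma basis_in_span (I : eqType) (e : I -> V) v :
  is_basis e -> v \in in_span (range e).
Proof. by move=> [_ span_e]; apply/asboolP; rewrite span_e. Qed.

Lemma spanning_basis (I : eqType) (e : I -> V) :
  linearly_independent e -> (forall v, v \in in_span (range e)) -> is_basis e.
Proof.
move=> free_e span_e; split=> //; apply/seteqP; split=> // v _.
by have /asboolP := span_e v.
Qed.

(** Independence speaks of relations without repeated indices, so the terms of
    the given relation are first collected by index; all their total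
    coefficients then vanish. *)
Lemma linearly_independent_transfer (V' : lmodType K) (I : eqType)
    (e : I -> V) (g : I -> V') (s : seq (K * I)) :
    linearly_independent e -> \sum_(x <- s) x.1 *: e x.2 = 0 ->
  \sum_(x <- s) x.1 *: g x.2 = 0.
Proof.
move=> free_e; pose r := undup [seq x.2 | x <- s].
pose c i := \sum_(x <- s | x.2 == i) x.1.
have collect (U : lmodType K) (h : I -> U) :
    \sum_(x <- s) x.1 *: h x.2 = \sum_(i <- r) c i *: h i.
  transitivity (\sum_(i <- r) \sum_(x <- s | x.2 == i) x.1 *: h x.2); last first.
    apply: eq_bigr => i _; rewrite scaler_suml.
    by apply: eq_bigr => x /eqP->.
  rewrite (exchange_big_dep predT) //= big_seq [RHS]big_seq.
  apply: eq_bigr => x xs; have xr : x.2 \in r by rewrite mem_undup map_f.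
  rewrite [RHS]big_mkcond (bigD1_seq _ xr (undup_uniq _)) /= eqxx big1 ?addr0 // => i.
  by rewrite eq_sym; case: eqP.
rewrite !collect => /(free_e _ _ (undup_uniq _)) c0.
by rewrite big_seq big1 // => i /c0->; rewrite scale0r.
Qed.

(** The values of the extension are defined by a relation between a combination
    of the basis and the same combination of its prescribed images;
    independence makes the relation functional and spanning makes it total. *)
Lemma linear_extension (V' : lmodType K) (I : eqType) (e : I -> V)
    (g : I -> V') :
  is_basis e -> exists phi : {linear V -> V'}, forall i, phi (e i) = g i.
Proof.
move=> base_e; have [free_e _] := base_e.
pose R v y := exists2 s : seq (K * I), v = \sum_(x <- s) x.1 *: e x.2 &
  y = \sum_(x <- s) x.1 *: g x.2.
have R_lin k u v y z : R u y -> R v z -> R (k *: u + v) (k *: y + z).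
  move=> [s -> ->] [t -> ->]; exists ([seq (k * x.1, x.2) | x <- s] ++ t);
  rewrite big_cat big_map /= scaler_sumr; congr (_ + _);
  by apply: eq_bigr => x _; rewrite scalerA.
have R_fun v y z : R v y -> R v z -> y = z.
  move=> /(R_lin (-1)) Ry /Ry; rewrite !scaleN1r addNr => -[s /esym s0 yz].
  move: yz; rewrite (linearly_independent_transfer _ free_e s0).
  by rewrite addrC => /subr0_eq.
have R_tot v : exists y, R v y.
  have := basis_in_span v base_e; elim/in_span_ind: v / => [|k u v [y Ry] [z Rz]|].
  - by exists 0; exists [::]; rewrite big_nil.
  - by exists (k *: y + z); exact: R_lin.
  - by move=> _ [i _ <-]; exists (g i); exists [:: (1, i)]; rewrite big_seq1 scale1r.
have [f Rf] := choice R_tot.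
have f_lin : linear f by move=> k u v; apply: R_fun (Rf _) (R_lin _ _ _ _ _ _ _).
pose f_mixin := GRing.isLinear.Build K V V' *:%R f f_lin.
pose phi : {linear V -> V'} := HB.pack f f_mixin.
exists phi => i; apply: R_fun (Rf (e i)) _.
by exists [:: (1, i)]; rewrite big_seq1 scale1r.
Qed.

Section Triangular.
Variables (I : eqType) (e f : I -> V) (ht : I -> nat) (c : I -> K).
Hypothesis c_neq0 : forall i, c i != 0.

Definition lower (g : I -> V) (i : I) : set V :=
  [set g j | j in [set j | (ht j < ht i)%N]].

Hypothesis tri : forall i, f i - c i *: e i \in in_span (lower e i).

(** Solve for e i and substitute recursively for the lower e j. *)
Lemma triangular_inverse i : e i - (c i)^-1 *: f i \in in_span (lower f i).
Proof.
have [n] := ubnP (ht i); elim: n i => // n IHn i lt_n.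
have -> : e i - (c i)^-1 *: f i = - (c i)^-1 *: (f i - c i *: e i).
  by rewrite scalerBr scaleNr scaleNr scalerA mulVf // scale1r opprK addrC.
rewrite rpredZ //; apply: in_span_min (tri i) => _ [j /= lt_ji <-].
rewrite -(subrK ((c j)^-1 *: f j) (e j)) rpredD ?rpredZ //; last first.
  by apply: mem_in_span; exists j.
have /in_span_min := IHn j (leq_trans lt_ji lt_n); apply=> _ [l /= lt_lj <-].
by apply: mem_in_span; exists l => //=; apply: ltn_trans lt_ji.
Qed.

(** Spanning comes from the inverse triangular system.  For independence, in a
    relation between the f i, the coordinate along e m, for m of maximal height
    among the indices that occur, only sees the coefficient of f m. *)
Lemma triangular_basis : is_basis e -> is_basis f.
Proof.
move=> base_e; apply: spanning_basis => [s k s_uniq kf0 i i_s | v].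
- apply: contraTeq isT => ki_neq0 /=.
  pose live n := has (fun j => (k j != 0) && (ht j == n)) s.
  have live_ex : exists n, live n.
    by exists (ht i); apply/hasP; exists i; rewrite ?ki_neq0 /=.
  have live_bound n : live n -> (n <= \max_(j <- s) ht j)%N.
    by move=> /hasP[j j_s /andP[_ /eqP <-]]; exact: leq_bigmax_seq.
  have [n /hasP[m m_s /andP[km_neq0 /eqP ht_m]] n_max] :=
    ex_maxnP live_ex live_bound.
  have [phi phiE] := linear_extension (fun j => (j == m)%:R : K^o) base_e.
  (* Every f j with k j nonzero has height at most that of m, so its lower terms
     do not involve e m. *)
  have phi_f j : j \in s -> k j *: phi (f j) = k j *: (c j *: (j == m)%:R : K^o).
    move=> j_s; have [->|kj_neq0] := eqVneq (k j) 0; first by rewrite !scale0r.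
    congr (_ *: _); apply/eqP; rewrite -phiE -linearZ_LR -subr_eq0 -linearB; apply/eqP.
    move: (tri j); elim/in_span_ind: (_ - _) / => [|d u v u0 v0|].
    - exact: linear0.
    - by rewrite linearP u0 v0 scaler0 addr0.
    move=> _ [l /= lt_l <-]; rewrite phiE; case: eqP lt_l => // -> lt_mj.
    have: live (ht j) by apply/hasP; exists j; rewrite // kj_neq0 /=.
    by move=> /n_max; rewrite -ht_m leqNgt lt_mj.
  have: phi (\sum_(j <- s) k j *: f j) = 0 by rewrite kf0 linear0.
  rewrite linear_sum (bigD1_seq m) //= linearZ_LR phi_f //= eqxx big_seq_cond big1.
    move/eqP; rewrite addr0 /GRing.scale /= mulr1 mulf_eq0.
    by rewrite (negPf km_neq0) (negPf (c_neq0 _)).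
  move=> j /andP[j_s /negPf j_m].
  by rewrite linearZ_LR phi_f // j_m scaler0 scaler0.
- apply: in_span_min (basis_in_span v base_e) => _ [i _ <-].
  rewrite -(subrK ((c i)^-1 *: f i) (e i)) rpredD ?rpredZ //.
    apply: in_span_min (triangular_inverse i) => _ [j _ <-].
    by apply: mem_in_span; exists j.
  by apply: mem_in_span; exists i.
Qed.

End Triangular.

End LinearAlgebra.

Lemma linear_in_span (K : fieldType) (V V' : lmodType K)
    (phi : {linear V -> V'}) (A : set V) (B : set V') (v : V) :
    (forall x, A x -> phi x \in in_span B) ->
  v \in in_span A -> phi v \in in_span B.
Proof.
move=> AB; elim/in_span_ind: v / => // [|k u v Bu Bv].
  by rewrite linear0 rpred0.
by rewrite linearP rpredD ?rpredZ.
Qed.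

(** * Cocentres and group algebras *)

Section Cocentre.
Variables (K : fieldType) (H : algType K).

Lemma to_cocentre_is_linear : linear (@to_cocentre K H).
Proof.
by move=> k x y; rewrite /to_cocentre pi_addr pi_scale.
Qed.

HB.instance Definition _ :=
  GRing.isLinear.Build K H (cocentre H) *:%R (@to_cocentre K H)
    to_cocentre_is_linear.

Lemma to_cocentre_eq0 (x : H) :
  (to_cocentre x == 0) = (x \in in_span (@commutators K H)).
Proof. by rewrite -(linear0 (@to_cocentre K H)) -Quotient.idealrBE subr0. Qed.

Lemma to_cocentre_mulC (x y : H) : to_cocentre (x * y) = to_cocentre (y * x).
Proof.
apply/eqP; rewrite -subr_eq0 -linearB to_cocentre_eq0.
by apply: mem_in_span; exists x, y.
Qed.

Lemma trace_in_span (V : lmodType K) (A : set H) (phi : {linear H -> V}) :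
    (forall x y, A x -> A y -> phi (x * y) = phi (y * x)) ->
  forall x y, x \in in_span A -> y \in in_span A -> phi (x * y) = phi (y * x).
Proof.
move=> phiA x y; elim/in_span_ind: x / => [|k u v IHu IHv|x Ax].
- by rewrite mul0r mulr0.
- move=> Ay; rewrite mulrDl mulrDr -scalerAl -scalerAr !linearP.
  by rewrite IHu ?IHv.
elim/in_span_ind: y / => [|k u v IHu IHv|y Ay]; last exact: phiA.
- by rewrite mul0r mulr0.
- by rewrite mulrDl mulrDr -scalerAl -scalerAr !linearP IHu IHv.
Qed.

End Cocentre.

Section GroupAlgebra.
Variable W : groupType.

Definition conj_class (w : W) : set W := [set (w ^ x)%g | x in [set: W]].

Lemma conj_class_refl w : conj_class w w.
Proof. by exists 1%g => //; rewrite conjg1. Qed.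

Lemma conj_class_in w : conj_class w \in conj_classes W.
Proof. by apply/mem_set; exists w. Qed.

Lemma conj_classes_eq (O : set W) w : conj_classes W O -> O w -> O = conj_class w.
Proof.
move=> [v ->] [x _ <-]; apply/seteqP; split=> _ [y _ <-].
  by exists (x^-1 * y)%g => //; rewrite -conjgM mulVKg.
by exists (x * y)%g => //; rewrite conjgM.
Qed.

Variables (K : fieldType) (H : algType K) (U : W -> H).
Hypothesis U_mul : forall v w, U (v * w)%g = U v * U w.

Lemma to_cocentre_conj v w :
  conj_class v w -> to_cocentre (U w) = to_cocentre (U v).
Proof.
by move=> [x _ <-]; rewrite conjgE U_mul to_cocentre_mulC -U_mul mulgK.
Qed.

(** In a group algebra, conjugate elements agree in the cocentre, which gives
    spanning; the indicator function of a conjugacy class is a trace, hence a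
    linear form on the cocentre, and these forms separate the classes. *)
Lemma group_algebra_cocentre_basis (r : conj_classes W -> W) :
    is_basis U -> (forall O, val O (r O)) ->
  is_basis (fun O => to_cocentre (U (r O))).
Proof.
move=> base_U r_in; apply: spanning_basis => [s k s_uniq sum0 O O_s | v].
- have [phi phiU] := linear_extension (fun w => (`[< val O w >])%:R : K^o) base_U.
  have phi_trace x y : phi (x * y) = phi (y * x).
    apply: (@trace_in_span _ _ _ (range U)); try exact: basis_in_span.
    move=> _ _ [v _ <-] [w _ <-]; rewrite -!U_mul !phiU.
    have O_class : conj_classes W (val O) by exact: set_mem (valP O).
    have O_conj t z : val O z -> val O (z ^ t)%g.
      by move=> Oz; rewrite (conj_classes_eq O_class Oz); exists t.
    congr (_%:R); congr (nat_of_bool _); apply: asbool_equiv_eq; split.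
      by move=> /(O_conj v); rewrite conjgE -mulgA mulKg.
    by move=> /(O_conj w); rewrite conjgE -mulgA mulKg.
  have phi_comm x : x \in in_span (@commutators K H) -> phi x = 0.
    elim/in_span_ind: x / => [|c x y x0 y0|_ [x [y ->]]]; first exact: linear0.
      by rewrite linearP x0 y0 scaler0 addr0.
    by rewrite linearB phi_trace subrr.
  have: phi (\sum_(P <- s) k P *: U (r P)) = 0.
    apply: phi_comm; rewrite -to_cocentre_eq0 linear_sum -[X in _ == X]sum0.
    by apply/eqP; apply: eq_bigr => P _; rewrite linearZ.
  rewrite linear_sum (bigD1_seq O) //= linearZ_LR phiU asboolT // big1.
    by rewrite addr0 /GRing.scale /= mulr1.
  move=> P P_O; rewrite linearZ_LR phiU asboolF ?scaler0 // => O_rP.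
  case/eqP: P_O; apply: val_inj.
  rewrite (conj_classes_eq (set_mem (valP O)) O_rP).
  exact: conj_classes_eq (set_mem (valP P)) (r_in P).
- rewrite -[v]reprK -/(to_cocentre _).
  apply: linear_in_span (basis_in_span (repr v) base_U) => _ [w _ <-].
  apply: mem_in_span; exists (SigSub (conj_class_in w)) => //.
  exact: to_cocentre_conj (r_in (SigSub (conj_class_in w))).
Qed.

End GroupAlgebra.

(** * Words and lengths in a Coxeter system *)

Section Coxeter.
Variables (W : groupType) (S : {fset W}).

Lemma word_prod_cat (u v : seq S) :
  word_prod (u ++ v) = (word_prod u * word_prod v)%g.
Proof. by rewrite /word_prod big_cat. Qed.

Lemma word_prod_cons (s : S) u : word_prod (s :: u) = (val s * word_prod u)%g.
Proof. by rewrite /word_prod big_cons. Qed.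

Lemma order_is1 (x : W) : order_is x 1 -> x = 1%g.
Proof. by case. Qed.

Lemma order_is_uniq (x : W) m n : order_is x m -> order_is x n -> m = n.
Proof.
move=> [m0 xm mP] [n0 xn nP]; case: (ltngtP m n) => // lt_mn.
  by case: (nP m); rewrite ?m0.
by case: (mP n); rewrite ?n0.
Qed.

Hypothesis coxS : coxeter_system S.

Lemma val_sq (s : S) : (val s * val s)%g = 1%g.
Proof. by have [/(_ s)[_ + _] _ _] := coxS; rewrite expg2. Qed.

Lemma val_neq1 (s : S) : val s <> 1%g.
Proof. by have [/(_ s)[_ _ /(_ 1%N isT) ?] _ _] := coxS. Qed.

(** The universal property of the Coxeter presentation. *)
Lemma coxeter_lift (R : pzRingType) (g : S -> R) :
    (forall s t m, order_is (val s * val t)%g m -> (g s * g t) ^+ m = 1) ->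
  exists U : W -> R, (forall u, U (word_prod u) = \prod_(s <- u) g s) /\
    forall v w, U (v * w)%g = U v * U w.
Proof.
move=> g_rel; have [_ gen pres] := coxS.
have [red redE] := choice gen; pose U w := \prod_(s <- red w) g s.
have UE u : U (word_prod u) = \prod_(s <- u) g s.
  have := pres _ _ (esym (redE (word_prod u))); rewrite /U.
  move: (red _) => r; elim=> // [s t m /g_rel gm | v v' w _ -> _ -> //
            | v v' w w' _ IHv _ IHw]; last by rewrite !big_cat IHv IHw.
  rewrite big_nil -[RHS]gm; elim: m {gm} => [|m IHm]; first by rewrite big_nil.
  by rewrite /= !big_cons IHm mulrA -exprS.
exists U; split=> // v w; rewrite {1}[v]redE {1}[w]redE -word_prod_cat UE.
by rewrite big_cat.
Qed.

(** The sign character: all relators of a Coxeter presentation are even. *)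
Lemma word_parity (u v : seq S) :
  word_prod u = word_prod v -> odd (size u) = odd (size v).
Proof.
have [_ _ pres] := coxS; move/pres.
elim=> // [s t m _ | x y z _ -> _ -> // | x x' y y' _ IHx _ IHy].
  by elim: m => [|m IHm] //=; rewrite negbK.
by rewrite !size_cat !oddD IHx IHy.
Qed.

Lemma word_lengthP (w : W) :
  (exists2 u : seq S, size u = word_length S w & w = word_prod u) /\
  forall u : seq S, w = word_prod u -> (word_length S w <= size u)%N.
Proof.
apply: (@xgetPex _ 0%N [set n | (exists2 u : seq S, size u = n & w = word_prod u) /\
  forall u : seq S, w = word_prod u -> (n <= size u)%N]).
have [_ /(_ w)[u0 u0E] _] := coxS.
pose p n := `[< exists2 u : seq S, size u = n & w = word_prod u >].
have p_ex : exists n, p n by exists (size u0); apply/asboolP; exists u0.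
have [n /asboolP np n_min] := ex_minnP p_ex.
by exists n; split=> // u uE; apply: n_min; apply/asboolP; exists u.
Qed.

Lemma word_length_le (u : seq S) : (word_length S (word_prod u) <= size u)%N.
Proof. by have [_ ->] := word_lengthP (word_prod u). Qed.

Lemma word_length1 : word_length S 1%g = 0%N.
Proof.
by apply/eqP; rewrite -leqn0; have := word_length_le [::]; rewrite /word_prod big_nil.
Qed.

Lemma word_length_eq0 w : word_length S w = 0%N -> w = 1%g.
Proof.
have [[u <- ->] _ /size0nil->] := word_lengthP w.
by rewrite /word_prod big_nil.
Qed.

Lemma word_length_gen (s : S) : word_length S (val s) = 1%N.
Proof.
have := word_length_le [:: s]; rewrite word_prod_cons /word_prod big_nil mulg1 /=.
by case E: word_length => [|[|]] // _; case: (val_neq1 (word_length_eq0 E)).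
Qed.

Lemma word_length_pair (s t : S) : s <> t -> word_length S (val s * val t)%g = 2%N.
Proof.
move=> s_t; have := word_length_le [:: s; t].
rewrite !word_prod_cons /word_prod big_nil mulg1 /=.
have [[u <- uE] _] := word_lengthP (val s * val t)%g.
have := @word_parity [:: s; t] u.
rewrite !word_prod_cons {1}/word_prod big_nil mulg1 /= => /(_ uE).
case: u uE => [|? [|? [|]]] //= stE _ _.
case: s_t; apply: val_inj; apply: (mulIg (val t)); rewrite val_sq stE.
by rewrite /word_prod big_nil.
Qed.

End Coxeter.

(** * Right-angled Hecke algebras *)

Section Hecke.
Variables (K : fieldType) (W : groupType) (S : {fset W}).
Variables (a b : S -> K) (H : algType K) (T : W -> H).
Hypotheses (coxS : coxeter_system S) (raS : right_angled S).
Hypothesis heckeT : generic_hecke_algebra a b T.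

Lemma hecke_quadratic (s : S) : T (val s) * T (val s) = a s *: T (val s) + (b s)%:A.
Proof.
have [_ T1 _ down] := heckeT; have := down s (val s).
by rewrite (val_sq coxS) T1 word_length1 // word_length_gen //; apply.
Qed.

(** Both products are T_(st) because st has length 2; parity of lengths excludes
    that st is itself a generator. *)
Lemma hecke_commute (s t : S) :
  order_is (val s * val t)%g 2 -> T (val s) * T (val t) = T (val t) * T (val s).
Proof.
move=> ord2; have s_t : s <> t.
  move=> s_t; have: order_is (val s * val t)%g 1.
    split=> // [|m]; last by rewrite ltnNge; case: m.
    by rewrite s_t val_sq // expg1.
  by move=> /(order_is_uniq ord2).
have [_ _ up _] := heckeT.
have stC : (val s * val t = val t * val s)%g.
  have [_ st2 _] := ord2; apply: (mulIg (val s * val t)%g).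
  rewrite -expg2 st2 mulgA -[(_ * val s * val s)%g]mulgA val_sq //.
  by rewrite mulg1 val_sq.
have t_s : t <> s by move/esym.
by rewrite !up ?word_length_gen ?word_length_pair // stC.
Qed.

Lemma hecke_reduced (u : seq S) : size u = word_length S (word_prod u) ->
  T (word_prod u) = \prod_(s <- u) T (val s).
Proof.
have [_ T1 up _] := heckeT; elim: u => [|s u IHu] red_u.
  by rewrite big_nil /word_prod big_nil.
have red_u' : size u = word_length S (word_prod u).
  apply/eqP; rewrite eqn_leq (word_length_le coxS) andbT.
  have [[v <- uE] _] := word_lengthP coxS (word_prod u).
  have := word_length_le coxS (s :: v).
  by rewrite word_prod_cons -uE -word_prod_cons -red_u.
rewrite big_cons -IHu // word_prod_cons up //.
by rewrite -word_prod_cons -red_u -red_u' ltnS.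
Qed.

(** Completing the square in T_s^2 = a_s T_s + b_s; the scalar d s stands for a
    square root of the discriminant, which makes this element an involution. *)
Definition involutive_generator (d : S -> K) (s : S) : H :=
  (d s)^-1 *: (2 *: T (val s) - (a s)%:A).

Variable d : S -> K.
Hypothesis d_sq : forall s, d s ^+ 2 = a s ^+ 2 + 4 * b s.
Hypothesis d_neq0 : forall s, d s != 0.
Hypothesis two_neq0 : 2 != 0 :> K.

Local Notation g := (involutive_generator d).

Lemma involutive_generator_sq (s : S) : g s * g s = 1.
Proof.
rewrite /involutive_generator -scalerAl -scalerAr scalerA.
have -> : (2 *: T (val s) - (a s)%:A) * (2 *: T (val s) - (a s)%:A)
    = (d s ^+ 2)%:A.
  rewrite mulrBl !mulrBr -!scalerAl -!scalerAr !mul1r !mulr1 hecke_quadratic.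
  rewrite d_sq !scalerDr !scalerA !scalerDl.
  rewrite opprB -!scaleNr -addrA addrCA -addrA [_%:A + (_%:A + _)]addrA.
  rewrite [X in _ + X]addrCA addrCA -!scalerDl.
  have -> : - (2 * a s) + (2 * 2 * a s + - (a s * 2)) = 0 by ring.
  by rewrite scale0r addr0; congr (_ *: _); ring.
by rewrite scalerA -invfM -expr2 mulVf ?expf_neq0 ?scale1r.
Qed.

Lemma hecke_generatorE (s : S) :
  T (val s) = (a s / 2)%:A + (d s / 2) *: g s.
Proof.
rewrite /involutive_generator scalerA mulrAC mulfV // mul1r scalerBr !scalerA.
by rewrite mulVf // scale1r [2^-1 * _]mulrC addrC subrK.
Qed.

(** Right-angledness leaves only m = 1, where s = t, and m = 2, where the two
    involutions commute. *)
Lemma involutive_generator_rel (s t : S) m :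
  order_is (val s * val t)%g m -> (g s * g t) ^+ m = 1.
Proof.
move=> ord_m; case: (raS s t) => [ord1|ord2|/(_ m)]; last first.
- by case: ord_m => m_gt0 xm _ /(_ m_gt0).
- rewrite (order_is_uniq ord_m ord2).
  have gC x r : GRing.comm x (T (val r)) -> GRing.comm x (g r).
    rewrite /GRing.comm /involutive_generator -scalerAl -scalerAr mulrBl mulrBr.
    by rewrite -!scalerAl -!scalerAr mul1r mulr1 => ->.
  have gsC : GRing.comm (g s) (g t).
    by apply/gC/commr_sym/gC/commr_sym/hecke_commute.
  by rewrite exprMn_comm // !expr2 !involutive_generator_sq mulr1.
- rewrite (order_is_uniq ord_m ord1) expr1.
  have -> : s = t.
    by apply: val_inj; apply: (mulIg (val t)); rewrite val_sq //; exact: order_is1.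
  exact: involutive_generator_sq.
Qed.

(** Expanding the factors T_s = a_s/2 + (d_s/2) g_s along a reduced word of w,
    the choice of g_s everywhere gives a nonzero multiple of U w; every other
    choice drops a letter and gives a strictly shorter element. *)
Lemma hecke_triangular : exists (U : W -> H) (c : W -> K),
  [/\ forall v w, U (v * w)%g = U v * U w, forall w, c w != 0 &
      forall w, T w - c w *: U w \in
        in_span (lower (word_length S) U w)].
Proof.
have [U [UE U_mul]] := coxeter_lift coxS involutive_generator_rel.
pose below n := [set U v | v in [set v | (word_length S v < n)%N]].
have Ug s w : g s * U w = U (val s * w)%g.
  have := UE [:: s]; rewrite word_prod_cons /word_prod big_nil mulg1 big_seq1.
  by move=> <-; rewrite -U_mul.
have belowS n x : x \in in_span (below n) -> x \in in_span (below n.+1).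
  apply: in_span_min => _ [v /= lt_vn <-]; apply: mem_in_span; exists v => //=.
  exact: leqW.
have g_below n s x : x \in in_span (below n) -> g s * x \in in_span (below n.+1).
  elim/in_span_ind: x / => [|k x y IHx IHy|_ [v /= lt_vn <-]].
  - by rewrite mulr0 rpred0.
  - by rewrite mulrDr -scalerAr rpredD ?rpredZ.
  rewrite Ug; apply: mem_in_span; exists (val s * v)%g => //=.
  have [[u su ->] _] := word_lengthP coxS v; rewrite -word_prod_cons.
  by apply: leq_ltn_trans (word_length_le coxS _) _; rewrite /= su.
pose c (u : seq S) := \prod_(s <- u) (d s / 2).
have expand u : \prod_(s <- u) T (val s) - c u *: U (word_prod u)
    \in in_span (below (size u)).
  elim: u => [|s u IHu]; first by rewrite /c UE !big_nil scale1r subrr rpred0.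
  rewrite /c !big_cons -/(c u) word_prod_cons -Ug.
  move: IHu; set X := \prod_(_ <- _) _; set Y := U _ => XY.
  have -> : T (val s) * X - (d s / 2 * c u) *: (g s * Y)
      = (a s / 2) *: X + (d s / 2) *: (g s * (X - c u *: Y)).
    rewrite hecke_generatorE; move: (g s) => gs.
    rewrite mulrDl -!scalerAl mul1r mulrBr scalerBr -scalerAr scalerA.
    by rewrite addrA.
  rewrite rpredD ?rpredZ //; last exact: g_below.
  rewrite -(subrK (c u *: Y) X) rpredD ?rpredZ //; first exact: belowS.
  by apply: mem_in_span; exists (word_prod u) => //; exact: (word_length_le coxS).
have red w : exists u : seq S, size u = word_length S w /\ w = word_prod u.
  by have [[u] ? ? _] := word_lengthP coxS w; exists u.
have [r rP] := choice red; exists U, (c \o r); split=> // w.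
  rewrite /= /c prodf_seq_neq0; apply/allP => s _ /=.
  by rewrite mulf_neq0 // invr_eq0.
have [size_r wE] := rP w.
have -> : T w = \prod_(s <- r w) T (val s).
  by rewrite {1}wE hecke_reduced // -wE.
by move: (expand (r w)); rewrite -wE size_r.
Qed.

End Hecke.

Lemma closed_field_sqrt (K : closedFieldType) (x : K) : exists y : K, y ^+ 2 = x.
Proof.
have [y yE] := GRing.solve_monicpoly 2 (fun i => if i == 0%N then x else 0) isT.
by exists y; rewrite yE !big_ord_recl big_ord0 /= expr0 mulr1 mul0r !addr0.
Qed.

Theorem theorem6p6 (K : closedFieldType) (W : groupType) (S : {fset W})
    (a b : S -> K) (H : algType K) (T : W -> H) :
  (2%N \notin [pchar K]) ->
  coxeter_system S -> right_angled S ->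
  generic_hecke_algebra a b T ->
  (forall s : S, b s != - (a s ^+ 2 / 4%:R)) ->
  is_basis (fun O : conj_classes W => T_class S T (val O)).
Proof.
move=> char2 coxS raS heckeT b_neq.
have two_neq0 : 2 != 0 :> K by move: char2; rewrite !inE.
have [d d_sq] := choice (fun s => closed_field_sqrt (a s ^+ 2 + 4 * b s)).
have d_neq0 s : d s != 0.
  rewrite -sqrf_eq0 d_sq; apply: contra (b_neq s) => /eqP disc0.
  have four_neq0 : 4 != 0 :> K.
    by rewrite (_ : 4 = 2 * 2); [rewrite mulf_neq0 | ring].
  apply/eqP; apply: (mulfI four_neq0); rewrite mulrN mulrCA mulfV // mulr1.
  by apply/eqP; rewrite -addr_eq0 addrC disc0.
have [U [c [U_mul c_neq0 tri]]] :=
  hecke_triangular coxS raS heckeT d_sq d_neq0 two_neq0.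
have [base_T _ _ _] := heckeT.
have base_U : is_basis U.
  apply: (triangular_basis (ht := word_length S) (c := fun w => (c w)^-1))
    base_T => w; first by rewrite invr_eq0.
  exact: triangular_inverse c_neq0 tri w.
pose r (O : conj_classes W) := min_length_rep S (val O).
have r_min O : val O (r O) /\
    forall v, val O v -> (word_length S (r O) <= word_length S v)%N.
  apply: (@xgetPex _ 1%g [set w | val O w /\
    forall v, val O v -> (word_length S w <= word_length S v)%N]).
  have [w OE] := set_mem (valP O).
  pose p n := `[< exists2 v, val O v & word_length S v = n >].
  have p_ex : exists n, p n.
    exists (word_length S w); apply/asboolP; exists w => //.
    by rewrite OE; exact: conj_class_refl.
  have [n /asboolP[v Ov <-] n_min] := ex_minnP p_ex.
  by exists v; split=> // v' Ov'; apply: n_min; apply/asboolP; exists v'.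
have base_UO : is_basis (fun O => to_cocentre (U (r O))).
  by apply: group_algebra_cocentre_basis => // O; have [] := r_min O.
apply: (triangular_basis (ht := fun O => word_length S (r O))
  (c := fun O => c (r O))) base_UO => // O.
rewrite /T_class -/(r O) -linearZ_LR -linearB.
apply: linear_in_span (tri (r O)) => _ [v /= lt_v <-].
pose Ov : conj_classes W := SigSub (conj_class_in v).
have [v_r r_le] := r_min Ov.
apply: mem_in_span; exists Ov; last exact: to_cocentre_conj v_r.
by apply: leq_ltn_trans lt_v; apply/r_le/conj_class_refl.
Qed.
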